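(* Let $\Delta$ be a finite multiset of formulas of classical linear logic built from the grammar $A,B ::= \mathbf{1} \mid \bot \mid A\otimes B \mid A ⅋ B \mid A\oplus B \mid A \,\&\, B \mid {!A} \mid {?A}$. If the one-sided sequent $\vdash \Delta$ is provable in $\mathrm{CLL}+\mathrm{Mix}_0$, then the sequent $\vdash \Delta^{L\bot}, \mathbf{1}$ is provable in $\mathrm{CLL}+\mathrm{Mix}_0$, where $\Delta^{L\bot}$ is obtained by applying $(-)^{L\bot}$ to every formula of $\Delta$.
   Context: $\mathrm{CLL}+\mathrm{Mix}_0$ is the one-sided sequent calculus of classical (propositional, atom-free) linear logic with the usual rules for identity, cut, $\mathbf{1},\bot,\otimes,⅋,\oplus,\&,!,?$, weakening and contraction for $?$-formulas, together with the rule $\mathrm{Mix}_0$ deriving the empty sequent $\vdash\ \cdot$. Linear negation: $\mathbf{1}^\bot=\bot$, $\bot^\bot=\mathbf{1}$, $(A\otimes B)^\bot=A^\bot ⅋ B^\bot$, $(A⅋B)^\bot=A^\bot\otimes B^\bot$, $(A\oplus B)^\bot=A^\bot\&B^\bot$, $(A\&B)^\bot=A^\bot\oplus B^\bot$, $(!A)^\bot=?A^\bot$, $(?A)^\bot=!A^\bot$. The translation $(-)^{L\bot}$ (composition of Laurent's negative translation into intuitionistic linear logic with residual formula $\mathbf{1}$ and the embedding back into CLL) is defined by: $\bot^{L\bot}=\bot$; $\mathbf{1}^{L\bot}=\mathbf{1}\otimes\bot$; $(A\otimes B)^{L\bot}=((A^{L\bot}⅋\mathbf{1})\otimes(B^{L\bot}⅋\mathbf{1}))\otimes\bot$;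 $(A⅋B)^{L\bot}=A^{L\bot}⅋B^{L\bot}$; $(A\oplus B)^{L\bot}=((A^{L\bot}⅋\mathbf{1})\oplus(B^{L\bot}⅋\mathbf{1}))\otimes\bot$; $(A\&B)^{L\bot}=A^{L\bot}\&B^{L\bot}$; $(!A)^{L\bot}=!(A^{L\bot}⅋\mathbf{1})\otimes\bot$; $(?A)^{L\bot}=?((A^{L\bot}⅋\mathbf{1})\otimes\bot)$. *)

(* Defs.v *)
(* Stdlib only. *)
From Stdlib Require Export List Permutation.
Export ListNotations.

Inductive formula : Set :=
| One : formula
| Bot : formula
| Tensor : formula -> formula -> formula
| Par : formula -> formula -> formula
| Plus : formula -> formula -> formula
| With : formula -> formula -> formula
| OfCourse : formula -> formula
| WhyNot : formula -> formula.

Fixpoint dual (A : formula) : formula :=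
  match A with
  | One => Bot
  | Bot => One
  | Tensor A B => Par (dual A) (dual B)
  | Par A B => Tensor (dual A) (dual B)
  | Plus A B => With (dual A) (dual B)
  | With A B => Plus (dual A) (dual B)
  | OfCourse A => WhyNot (dual A)
  | WhyNot A => OfCourse (dual A)
  end.

(* A sequent is a finite multiset of formulas: a list, taken up to the rule
   [p_exchange].  The other rules can therefore act at the head of the list. *)
Definition sequent : Set := list formula.

(* [provable G]: the one-sided sequent G is derivable in CLL + Mix_0, with cut.
   There is no binary mix rule. *)
Inductive provable : sequent -> Prop :=
| p_exchange : forall G D, Permutation G D -> provable G -> provable D
| p_id : forall A, provable [A; dual A]
| p_cut : forall A G D,
    provable (A :: G) -> provable (dual A :: D) -> provable (G ++ D)
| p_mix0 : provable []
| p_one : provable [One]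
| p_bot : forall G, provable G -> provable (Bot :: G)
| p_tensor : forall A B G D,
    provable (A :: G) -> provable (B :: D) -> provable (Tensor A B :: G ++ D)
| p_par : forall A B G, provable (A :: B :: G) -> provable (Par A B :: G)
| p_plus_l : forall A B G, provable (A :: G) -> provable (Plus A B :: G)
| p_plus_r : forall A B G, provable (B :: G) -> provable (Plus A B :: G)
| p_with : forall A B G,
    provable (A :: G) -> provable (B :: G) -> provable (With A B :: G)
| p_promotion : forall A G,
    provable (A :: map WhyNot G) -> provable (OfCourse A :: map WhyNot G)
| p_dereliction : forall A G, provable (A :: G) -> provable (WhyNot A :: G)
| p_weakening : forall A G, provable G -> provable (WhyNot A :: G)
| p_contraction : forall A G,
    provable (WhyNot A :: WhyNot A :: G) -> provable (WhyNot A :: G).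

(* The translation (-)^{L\bot}: Laurent's negative translation into
   intuitionistic linear logic with residual formula 1, read back in CLL. *)
Fixpoint trL (A : formula) : formula :=
  match A with
  | Bot => Bot
  | One => Tensor One Bot
  | Tensor A B => Tensor (Tensor (Par (trL A) One) (Par (trL B) One)) Bot
  | Par A B => Par (trL A) (trL B)
  | Plus A B => Tensor (Plus (Par (trL A) One) (Par (trL B) One)) Bot
  | With A B => With (trL A) (trL B)
  | OfCourse A => Tensor (OfCourse (Par (trL A) One)) Bot
  | WhyNot A => WhyNot (Tensor (Par (trL A) One) Bot)
  end.

(* Main.v *)
Require Import Defs.
From Stdlib Require Import Lia.

(* Read [trL A] as the dual of an intuitionistic formula a.  Then
   [Par (trL A) One] is the negation of a with residual formula 1, and a
   formula [Tensor X Bot] in a sequent is a hypothesis "not X", being dual to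
   X -o 1.  Every rule translates directly except identity and cut: with a, a'
   the readings of A and its dual, these need "a, a' entail 1" and
   "not a, not a' entail 1", both proved by induction on A.  Mix_0 becomes the
   axiom for 1. *)

Lemma formula_eq_dec (A B : formula) : {A = B} + {A <> B}.
Proof. decide equality. Qed.

(** Two lists are permutations when every formula [x] occurs equally often in both; comparing [x]
    with each listed formula leaves linear arithmetic. *)
Ltac permutation :=
  apply (proj2 (Permutation_count_occ formula_eq_dec _ _));
  let x := fresh in
  intro x; repeat (simpl; rewrite ?count_occ_app);
  repeat destruct (formula_eq_dec _ x); lia.

Tactic Notation "exchange" constr(G) :=
  apply (p_exchange G); [permutation |].

Lemma p_id_sym (A : formula) : provable [dual A; A].
Proof. exchange [A; dual A]. apply p_id. Qed.

Lemma p_par_one (A : formula) (G : sequent) :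
  provable (One :: A :: G) -> provable (Par A One :: G).
Proof. intro H. apply p_par. exchange (One :: A :: G). exact H. Qed.

(** All of [G] goes with [A]; the residual [One] closes the [Bot] side. Read upwards, this consumes
    the [One] that [p_par_one] brings back. *)
Lemma p_tensor_bot (A : formula) (G : sequent) :
  provable (A :: G) -> provable (One :: Tensor A Bot :: G).
Proof.
  intro H. exchange (Tensor A Bot :: G ++ [One]).
  apply p_tensor; [exact H |]. apply p_bot, p_one.
Qed.

(** The components serve identity and cut. [Tensor (dual X) Bot] is the dual of [Par X One], so the
    second one can be cut against negations. *)
Definition dual_pair (X Y : formula) : Prop :=
  provable [One; X; Y] /\
  provable [One; Tensor (dual X) Bot; Tensor (dual Y) Bot].

Lemma dual_pair_sym (X Y : formula) : dual_pair X Y -> dual_pair Y X.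
Proof.
  intros [I C]; split.
  - exchange [One; X; Y]. exact I.
  - exchange [One; Tensor (dual X) Bot; Tensor (dual Y) Bot]. exact C.
Qed.

(** Both residual [One]s are absorbed into [Par X One] and [Par Y One], which are cut in turn
    against the second component; its own [One] survives. *)
Lemma dual_pair_cut (X Y : formula) (G D : sequent) :
  dual_pair X Y -> provable (One :: X :: G) -> provable (One :: Y :: D) ->
  provable (One :: G ++ D).
Proof.
  intros [_ C] HX HY.
  exchange (D ++ One :: G).
  apply (p_cut (Par Y One)); [apply p_par_one; exact HY | simpl].
  exchange (G ++ [One; Tensor (dual Y) Bot]).
  apply (p_cut (Par X One)); [apply p_par_one; exact HX | simpl].
  exchange [One; Tensor (dual X) Bot; Tensor (dual Y) Bot]. exact C.
Qed.

(** A cut whose [X] side comes from the identity on [X]. It serves to trade the negated hypotheses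
    in second components for plain formulas. *)
Lemma dual_pair_cut_neg (X Y : formula) (G : sequent) :
  dual_pair X Y -> provable (One :: Y :: G) ->
  provable (One :: Tensor (dual X) Bot :: G).
Proof.
  intros P H. apply (dual_pair_cut X Y [Tensor (dual X) Bot] G P); [| exact H].
  exchange [One; Tensor (dual X) Bot; X]. apply p_tensor_bot, p_id_sym.
Qed.

Lemma dual_pair_one_bot : dual_pair (Tensor One Bot) Bot.
Proof.
  split; simpl.
  - apply p_tensor_bot. exchange [Bot; One]. apply p_bot, p_one.
  - apply p_tensor_bot, p_par, p_bot, p_tensor_bot, p_one.
Qed.

Lemma dual_pair_tensor_par (X X' Y Y' : formula) :
  dual_pair X X' -> dual_pair Y Y' ->
  dual_pair (Tensor (Tensor (Par X One) (Par Y One)) Bot) (Par X' Y').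
Proof.
  intros PX PY; split; simpl.
  - exchange [Par X' Y'; One; Tensor (Tensor (Par X One) (Par Y One)) Bot].
    apply p_par.
    exchange (One :: Tensor (Tensor (Par X One) (Par Y One)) Bot :: [X'] ++ [Y']).
    apply p_tensor_bot, p_tensor; apply p_par_one; [apply PX | apply PY].
  - apply p_tensor_bot, p_par, p_par.
    (* The second [p_par] has released a fresh [One]; [N] is kept intact until both hypotheses are
       traded for [X'] and [Y']. *)
    set (N := Tensor (Tensor (dual X') (dual Y')) Bot).
    exchange [One; Tensor (dual X) Bot; Tensor (dual Y) Bot; N].
    apply (dual_pair_cut_neg X X'); [exact PX |].
    exchange [One; Tensor (dual Y) Bot; X'; N].
    apply (dual_pair_cut_neg Y Y'); [exact PY |].
    exchange (One :: N :: [X'] ++ [Y']).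
    apply p_tensor_bot, p_tensor; apply p_id_sym.
Qed.

Lemma dual_pair_plus_with (X X' Y Y' : formula) :
  dual_pair X X' -> dual_pair Y Y' ->
  dual_pair (Tensor (Plus (Par X One) (Par Y One)) Bot) (With X' Y').
Proof.
  intros PX PY; split; simpl.
  - apply p_tensor_bot.
    exchange [With X' Y'; Plus (Par X One) (Par Y One)]. apply p_with.
    + exchange [Plus (Par X One) (Par Y One); X'].
      apply p_plus_l, p_par_one, PX.
    + exchange [Plus (Par X One) (Par Y One); Y'].
      apply p_plus_r, p_par_one, PY.
  - apply p_tensor_bot, p_par.
    set (N := Tensor (Plus (dual X') (dual Y')) Bot).
    apply p_with.
    + exchange [One; Tensor (dual X) Bot; N].
      apply (dual_pair_cut_neg X X'); [exact PX |].
      exchange [One; N; X']. apply p_tensor_bot, p_plus_l, p_id_sym.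
    + exchange [One; Tensor (dual Y) Bot; N].
      apply (dual_pair_cut_neg Y Y'); [exact PY |].
      exchange [One; N; Y']. apply p_tensor_bot, p_plus_r, p_id_sym.
Qed.

(** Promotion tolerates only [WhyNot] formulas in the context, so [p_tensor_bot] first removes the
    [One]; the negation under [OfCourse] returns it afterwards. *)
Lemma dual_pair_ofcourse_whynot (X Y : formula) :
  dual_pair X Y ->
  dual_pair (Tensor (OfCourse (Par X One)) Bot)
            (WhyNot (Tensor (Par Y One) Bot)).
Proof.
  intro P; split; simpl.
  - apply p_tensor_bot.
    apply (p_promotion _ [Tensor (Par Y One) Bot]); simpl.
    exchange [WhyNot (Tensor (Par Y One) Bot); Par X One].
    apply p_dereliction. exchange [Par X One; Tensor (Par Y One) Bot].
    apply p_par_one.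
    exchange [One; Tensor (Par Y One) Bot; X].
    apply p_tensor_bot, p_par_one, (dual_pair_sym _ _ P).
  - apply p_tensor_bot, p_par.
    exchange [One; Tensor (OfCourse (Par (Tensor (dual Y) Bot) One)) Bot;
              WhyNot (Tensor (dual X) Bot)].
    apply p_tensor_bot.
    apply (p_promotion _ [Tensor (dual X) Bot]); simpl.
    exchange [WhyNot (Tensor (dual X) Bot); Par (Tensor (dual Y) Bot) One].
    apply p_dereliction.
    exchange [Par (Tensor (dual Y) Bot) One; Tensor (dual X) Bot].
    apply p_par_one, (dual_pair_sym _ _ P).
Qed.

Lemma dual_pair_trL (A : formula) : dual_pair (trL A) (trL (dual A)).
Proof.
  induction A; simpl.
  - apply dual_pair_one_bot.
  - apply dual_pair_sym, dual_pair_one_bot.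
  - apply dual_pair_tensor_par; assumption.
  (* Here [dual A] and [dual B] are the tensor factors, so the pair and the induction hypotheses are
     all flipped. *)
  - apply dual_pair_sym, dual_pair_tensor_par; apply dual_pair_sym; assumption.
  - apply dual_pair_plus_with; assumption.
  - apply dual_pair_sym, dual_pair_plus_with; apply dual_pair_sym; assumption.
  - apply dual_pair_ofcourse_whynot; assumption.
  - apply dual_pair_sym, dual_pair_ofcourse_whynot, dual_pair_sym; assumption.
Qed.

(** This puts a translated promotion context back into the shape that [p_promotion] demands. *)
Lemma map_trL_WhyNot (G : sequent) :
  map trL (map WhyNot G) =
  map WhyNot (map (fun A => Tensor (Par (trL A) One) Bot) G).
Proof. rewrite !map_map. reflexivity. Qed.

Lemma provable_trL (D : sequent) : provable D -> provable (One :: map trL D).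
Proof.
  induction 1; simpl in *; rewrite ?map_app.
  - apply (p_exchange (One :: map trL G)); [| assumption].
    apply perm_skip, Permutation_map; assumption.
  - apply dual_pair_trL.
  - eapply dual_pair_cut; [apply dual_pair_trL | eassumption ..].
  - apply p_one.
  - apply p_tensor_bot, p_one.
  - exchange (Bot :: One :: map trL G). apply p_bot; assumption.
  (* Each premise carries its own [One], absorbed into its tensor factor; the outer [Bot] accounts
     for the single [One] of the conclusion. *)
  - apply p_tensor_bot, p_tensor; apply p_par_one; assumption.
  - exchange (Par (trL A) (trL B) :: One :: map trL G). apply p_par.
    exchange (One :: trL A :: trL B :: map trL G). assumption.
  - apply p_tensor_bot, p_plus_l, p_par_one; assumption.
  - apply p_tensor_bot, p_plus_r, p_par_one; assumption.
  - exchange (With (trL A) (trL B) :: One :: map trL G). apply p_with.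
    + exchange (One :: trL A :: map trL G). assumption.
    + exchange (One :: trL B :: map trL G). assumption.
  - apply p_tensor_bot. rewrite map_trL_WhyNot in *.
    apply p_promotion, p_par_one; assumption.
  - set (N := Tensor (Par (trL A) One) Bot).
    exchange (WhyNot N :: One :: map trL G). apply p_dereliction.
    exchange (One :: N :: map trL G).
    apply p_tensor_bot, p_par_one; assumption.
  - set (N := Tensor (Par (trL A) One) Bot).
    exchange (WhyNot N :: One :: map trL G). apply p_weakening; assumption.
  - set (N := Tensor (Par (trL A) One) Bot) in *.
    exchange (WhyNot N :: One :: map trL G). apply p_contraction.
    exchange (One :: WhyNot N :: WhyNot N :: map trL G). assumption.
Qed.

Theorem theorem7 :
  forall D : sequent, provable D -> provable (map trL D ++ [One]).
Proof.
  intros D H. exchange (One :: map trL D). apply provable_trL, H.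
Qed.
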